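(* The connection number is $3$ for each of the following boards: the parallelogram $P(m_1,m_2)$ with $m_1,m_2\ge 3$; the triangle $T(m)$ with $m\ge 5$; and the flower $F(m)$ with $m\ge 3$.
   Context: Hexagons of the regular hexagonal tessellation of the plane are identified with points of $\mathbb{Z}^2$; two hexagons are adjacent (share an edge) iff their difference is one of $\pm(1,0),\pm(0,1),\pm(1,1)$. A board $B$ is a finite set of hexagons (positions). Families of boards: parallelogram $P(m_1,m_2)=\{0,\dots,m_1-1\}\times\{0,\dots,m_2-1\}$; triangle with $m$ hexagons on a side $T(m)=\{(i,j): 0\le j\le i\le m-1\}$; flower with $m$ layers $F(m)=\{(i,j):\max(|i|,|j|,|i-j|)\le m-1\}$. $B(h)$ denotes the board $B$ with $h$ holes, $h<|B|$: a configuration of $B(h)$ is a placement of $t=|B|-h$ tiles with distinct labels $1,\dots,t$ on distinct positions of $B$; the $h$ unoccupied positions are the holes (unlabeled; adjacent holes are counted separately). A slide moves a tile from its position $p$ to a hole $q$ adjacent to $p$, and is permitted iff there is another hole $r$ that is adjacent to both $p$ and $q$. The puzzle graph $puz[B(h)]$ has the configurations of $B(h)$ as vertices, with an edge between two configurations whenever one can be obtained from the other by one slide. A configuration is non-isolated if at least one slide is possible from it. $puz[B(h)]$ is maximally connected if there is at least one non-isolated configuration and all non-isolated configurations lie in a single connected component. The connection number of $B$ is the minimum $h$ such that $puz[B(h)]$ is maximally connected. *)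

(* Defs.v *)
From HB Require Import structures.
From mathcomp Require Import all_boot all_order all_algebra finmap.
From mathcomp Require Import zify.

Set Implicit Arguments.
Unset Strict Implicit.
Unset Printing Implicit Defensive.

Import Order.TTheory GRing.Theory Num.Theory.

Local Open Scope fset_scope.
Local Open Scope ring_scope.

Notation hexagon := (int * int)%type.

Definition adjacent (p q : hexagon) : bool :=
  ((q.1 - p.1, q.2 - p.2) : hexagon) \in
    [:: (1, 0); (-1, 0); (0, 1); (0, -1); (1, 1); (-1, -1)].

Definition board : Type := {fset hexagon}.

(* The square [-n, n]^2.  Finite-set comprehensions need a finite ambient set;
   the [in_*] lemmas below show that cutting down to it loses no hexagon. *)
Definition box (n : nat) : board :=
  [fset ((i%:Z - n%:Z, j%:Z - n%:Z) : hexagon)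
     | i in iota 0 n.*2.+1, j in iota 0 n.*2.+1].

Definition parallelogram (m1 m2 : nat) : board :=
  [fset p in box (maxn m1 m2)
     | (0 <= p.1 <= m1%:Z - 1) && (0 <= p.2 <= m2%:Z - 1)].

Definition triangle (m : nat) : board :=
  [fset p in box m | [&& 0 <= p.2, p.2 <= p.1 & p.1 <= m%:Z - 1]].

Definition flower (m : nat) : board :=
  [fset p in box m
     | Num.max (Num.max `|p.1| `|p.2|) `|p.1 - p.2| <= m%:Z - 1].

Lemma in_box (n : nat) (p : hexagon) :
  (p \in box n) = (- n%:Z <= p.1 <= n%:Z) && (- n%:Z <= p.2 <= n%:Z).
Proof.
apply/imfset2P/idP => [[i]|].
  rewrite inE mem_iota => Hi [j]; rewrite inE mem_iota => Hj -> /=; lia.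
case: p => a b /= H.
exists (absz (a + n%:Z)); first by rewrite inE mem_iota; lia.
exists (absz (b + n%:Z)); first by rewrite inE mem_iota; lia.
by congr pair; lia.
Qed.

Lemma in_parallelogram (m1 m2 : nat) (p : hexagon) :
  (p \in parallelogram m1 m2) =
  (0 <= p.1 <= m1%:Z - 1) && (0 <= p.2 <= m2%:Z - 1).
Proof. by rewrite !inE /= in_box; lia. Qed.

Lemma in_triangle (m : nat) (p : hexagon) :
  (p \in triangle m) = [&& 0 <= p.2, p.2 <= p.1 & p.1 <= m%:Z - 1].
Proof. by rewrite !inE /= in_box; lia. Qed.

Lemma in_flower (m : nat) (p : hexagon) :
  (p \in flower m) =
  (Num.max (Num.max `|p.1| `|p.2|) `|p.1 - p.2| <= m%:Z - 1).
Proof. by rewrite !inE /= in_box !ge_max; lia. Qed.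

Section Puzzle.
Variables (B : board) (h : nat).

(* The tiles are labelled 0, ..., t - 1 instead of 1, ..., t. *)
Definition tile : Type := 'I_(#|` B| - h).
HB.instance Definition _ := Finite.on tile.

Definition configuration : Type := {c : {ffun tile -> B} | injectiveb c}.
HB.instance Definition _ := Finite.on configuration.

Definition position (c : configuration) (i : tile) : B := val c i.

Definition is_hole (c : configuration) (q : B) : bool :=
  [forall i, position c i != q].

Definition permitted (c : configuration) (i : tile) (q : B) : bool :=
  [&& is_hole c q, adjacent (val (position c i)) (val q) &
      [exists r : B, [&& r != q, is_hole c r,
         adjacent (val (position c i)) (val r) & adjacent (val q) (val r)]]].

Definition slide (c c' : configuration) : bool :=
  [exists i, [exists q, [&& permitted c i q, position c' i == q &
     [forall j, (j != i) ==> (position c' j == position c j)]]]].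

Definition puz : rel configuration :=
  fun c c' => slide c c' || slide c' c.

Definition non_isolated (c : configuration) : bool :=
  [exists i, [exists q, permitted c i q]].

Definition maximally_connected : Prop :=
  (exists c, non_isolated c) /\
  (forall c c', non_isolated c -> non_isolated c' -> connect puz c c').

End Puzzle.

Definition connection_number_is (B : board) (h : nat) : Prop :=
  [/\ (h < #|` B|)%N, maximally_connected B h &
      forall h' : nat,
        (h' < #|` B|)%N -> maximally_connected B h' -> (h <= h')%N].

(* Main.v *)
Require Import Defs.
From mathcomp Require Import all_boot all_order all_algebra all_fingroup finmap.
From mathcomp Require Import zify.

(** With fewer than two holes no slide exists.  With two holes there is a parity
    obstruction.  Orient every pair of adjacent hexagons along (1,0), (0,1) or
    (-1,-1); then the boundary of every unit triangle of hexagons is a directed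
    cycle.  A slide with two holes moves a tile of a triangle whose other two
    corners are the holes; if the holes are kept in the order given by the
    orientation, it is a 3-cycle on tiles and holes together.  So only even
    rearrangements can be reached, and exchanging two tiles of a non-isolated
    configuration gives one in another component
    (lemma [not_maximally_connected2]).

    With three holes, call a region of the board flexible if any two
    configurations whose holes fill the same triangle of the region, and which
    agree outside the region, are joined by slides, and if moreover the triangles
    of the region are linked through common edges ([flexible]).  Three ideas show
    that a whole board is flexible.

    - A triangle of holes can roll over any of its edges, so it can be carried
      along any chain of triangles ([roll], [walk_holes3]).  Hence exchanges of
      tiles need to be exhibited for one position of the holes only.

    - The rhombus of 3 by 3 hexagons is flexible: explicit sequences of slides
      realize five transpositions that generate the symmetric group on its six
      tiles ([rhombus_exchanges], [flexible_rhombus]).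

    - If two flexible regions share a triangle and one more hexagon [w], their
      union is flexible ([flexible_union]): with the holes at the common triangle,
      the transpositions of [w] with all other hexagons are available, and they
      generate the full symmetric group.

    Parallelograms, triangles and flowers are then assembled from overlapping
    rhombi in the three orientations of the lattice.

    Finally every non-isolated configuration reaches one whose holes form a
    prescribed triangle ([non_isolated_to_face]): a pair of adjacent holes which is
    next to a tile can walk through the board, and it is walked until it meets
    the third hole. *)

Set Implicit Arguments.
Unset Strict Implicit.
Unset Printing Implicit Defensive.

Import Order.TTheory GRing.Theory Num.Theory.

(** * Triangles and exchanges of hexagons *)

(** Three mutually adjacent hexagons are a face of the dual triangulation of the
    plane. *)
Definition face (x y z : hexagon) : bool :=
  [&& adjacent x y, adjacent y z & adjacent x z].

Definition swap (p q x : hexagon) : hexagon :=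
  if x == p then q else if x == q then p else x.

(** Adjacency is nearness in the three coordinates [p.1], [p.2] and [p.1 - p.2];
    the linear form suits [lia]. *)
Lemma adjacentE (p q : hexagon) :
  adjacent p q =
  [&& p != q, `|q.1 - p.1| <= 1, `|q.2 - p.2| <= 1 &
      `|(q.1 - p.1) - (q.2 - p.2)| <= 1]%R.
Proof. by case: p q => [a b] [c d]; rewrite /adjacent !inE !xpair_eqE /=; lia. Qed.

Lemma adjacentC (p q : hexagon) : adjacent p q = adjacent q p.
Proof. by rewrite !adjacentE eq_sym; lia. Qed.

Lemma adjacent_neq (p q : hexagon) : adjacent p q -> p != q.
Proof. by rewrite adjacentE => /andP[]. Qed.

Lemma faceC (x y z : hexagon) : face x y z = face y x z.
Proof. by rewrite /face (adjacentC x y); congr (_ && _); apply: andbC. Qed.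

Lemma face_rot (x y z : hexagon) : face x y z = face y z x.
Proof. by rewrite /face (adjacentC y x) (adjacentC z x) [in RHS]andbA [in RHS]andbC. Qed.

Lemma swapL p q : swap p q p = q.
Proof. by rewrite /swap eqxx. Qed.

Lemma swapR p q : swap p q q = p.
Proof. by rewrite /swap eqxx; case: eqP. Qed.

Lemma swapN p q x : x != p -> x != q -> swap p q x = x.
Proof. by rewrite /swap => /negPf-> /negPf->. Qed.

Lemma swapC p q : swap p q =1 swap q p.
Proof. by move=> x; rewrite /swap; case: eqP => [->|//]; case: eqP => // ->. Qed.

Lemma swapK p q : involutive (swap p q).
Proof.
move=> x; have [->|xp] := eqVneq x p; first by rewrite swapL swapR.
have [->|xq] := eqVneq x q; first by rewrite swapR swapL.
by rewrite !swapN.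
Qed.

Lemma swap_conj w p q x : p != q -> p != w -> q != w ->
  swap w p (swap w q (swap w p x)) = swap p q x.
Proof.
move=> pq pw qw.
have [wp wq qp] : [/\ w != p, w != q & q != p] by split; rewrite eq_sym.
rewrite /swap; have [->|xw] := eqVneq x w.
  by rewrite /= (negPf pw) (negPf pq) (negPf pw) eqxx (negPf wp) (negPf wq).
have [_|xp] := eqVneq x p; first by rewrite /= eqxx (negPf qw) (negPf qp).
have [->|xq] := eqVneq x q; first by rewrite /= (negPf qw) eqxx.
by rewrite !(negPf xw, negPf xp, negPf xq).
Qed.

(** * Configurations and slides *)

Section Configurations.
Variables (B : board) (h : nat).
Implicit Types (c d : configuration B h) (p q x y z w : hexagon).

Definition pos c (i : tile B h) : hexagon := val (position c i).

Definition hole c x : bool := (x \in B) && [forall i, pos c i != x].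

Lemma pos_in c i : pos c i \in B.
Proof. exact: valP. Qed.

Lemma hole_in c x : hole c x -> x \in B.
Proof. by case/andP. Qed.

Lemma hole_pos c i : hole c (pos c i) = false.
Proof. by apply/negbTE/negP => /andP[_ /forallP /(_ i)]; rewrite eqxx. Qed.

Lemma is_holeE c (q : B) : is_hole c q = hole c (val q).
Proof. by rewrite /hole (valP q). Qed.

Lemma position_inj c : injective (position c).
Proof. by case: c => f f_inj; apply/injectiveP. Qed.

Lemma pos_inj c : injective (pos c).
Proof. by move=> i j /val_inj /position_inj. Qed.

Lemma pos_ext c d : pos c =1 pos d -> c = d.
Proof. by move=> cd; apply/val_inj/ffunP => i; apply/val_inj/cd. Qed.

Lemma swap_config c p q : p \in B -> q \in B ->
  exists d, forall i, pos d i = swap p q (pos c i).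
Proof.
move=> pB qB; pose s := tperm [` pB]%fset [` qB]%fset.
pose f : {ffun tile B h -> B} := [ffun i => s (position c i)].
have inj : injectiveb f.
  by apply/injectiveP => i j; rewrite !ffunE => /perm_inj /position_inj.
exists (exist (fun f : {ffun tile B h -> B} => is_true (injectiveb f)) f inj) => i.
rewrite /pos {1}/position /= ffunE /swap.
rewrite permE /=.
rewrite -!(inj_eq val_inj) /=; case: eqP => // _; by case: eqP.
Qed.

Lemma hole_swap c d p q x : (forall i, pos d i = swap p q (pos c i)) ->
  x \in B -> hole c (swap p q x) -> hole d x.
Proof.
move=> dE xB /andP[_ /forallP cx]; rewrite /hole xB; apply/forallP => i.
by apply: contraNneq (cx i) => <-; rewrite dE swapK.
Qed.

Lemma puz_sym : connect_sym (@puz B h).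
Proof. by apply: sym_connect_sym => c d; rewrite /puz orbC. Qed.

(** No tile is required at [x]: if [x] is a hole too, exchanging the contents of
    [x] and [y] changes nothing.  So a sequence of slides can be followed by the
    permutation of hexagons that it induces, without asking at each step where
    the third hole is. *)
Lemma slide_swap c x y z : x \in B -> face x y z -> hole c y -> hole c z ->
  exists2 d, connect (@puz B h) c d & forall i, pos d i = swap x y (pos c i).
Proof.
move=> xB /and3P[xy yz xz] cy cz; have yB := hole_in cy; have zB := hole_in cz.
have [d dE] := swap_config c xB yB; exists d => //.
have yN i : pos c i != y by apply: contraTneq cy => <-; rewrite hole_pos.
have [/existsP[i /eqP ci]|/existsPn nx] := boolP [exists i, pos c i == x]; last first.
  by rewrite (pos_ext (c := c) (d := d)) // => i; rewrite dE swapN.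
apply/connect1/orP; left; apply/existsP; exists i; apply/existsP; exists [` yB]%fset.
apply/and3P; split.
- rewrite /permitted is_holeE /= cy -[val (position c i)]/(pos c i) ci xy.
  by apply/existsP; exists [` zB]%fset;
  rewrite is_holeE -(inj_eq val_inj) /= cz xz yz eq_sym (adjacent_neq yz).
- by rewrite -(inj_eq val_inj) /= -[val (position d i)]/(pos d i) dE ci swapL.
apply/forallP => j; apply/implyP => ji; rewrite -(inj_eq val_inj).
by rewrite -[val (position d j)]/(pos d j) dE swapN // -ci (inj_eq (@pos_inj c)).
Qed.

Definition holes3 c x y z := [&& hole c x, hole c y & hole c z].

Definition agree_off (U : pred hexagon) c d :=
  forall i, pos c i = pos d i \/ U (pos c i) /\ U (pos d i).

Lemma agree_off_refl U c : agree_off U c c.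
Proof. by move=> i; left. Qed.

Lemma agree_off_sym U c d : agree_off U c d -> agree_off U d c.
Proof. by move=> cd i; case: (cd i) => [->|[]]; [left|right]. Qed.

Lemma agree_off_trans U d c c' :
  agree_off U c d -> agree_off U d c' -> agree_off U c c'.
Proof.
by move=> cd dc i; case: (cd i) (dc i) => [->//|[? ?]] [<-|[? ?]]; right.
Qed.

Lemma agree_off_swap (U : pred hexagon) c d p q : U p -> U q ->
  (forall i, pos d i = swap p q (pos c i)) -> agree_off U c d.
Proof.
move=> Up Uq dE i; rewrite dE /swap.
by case: eqP => [->|_]; [right|case: eqP => [->|]; [right|left]].
Qed.

(** * Sorting the tiles by exchanges *)

Definition swappable x y z p q := forall c, holes3 c x y z ->
  exists2 d, connect (@puz B h) c d & forall i, pos d i = swap p q (pos c i).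

Lemma swappableC x y z p q : swappable x y z p q -> swappable x y z q p.
Proof.
by move=> pq c /pq[d cd dE]; exists d => // i; rewrite dE swapC.
Qed.

Lemma holes3_swap c d p q x y z :
    p \notin [:: x; y; z] -> q \notin [:: x; y; z] ->
    (forall i, pos d i = swap p q (pos c i)) ->
  holes3 c x y z -> holes3 d x y z.
Proof.
rewrite !inE !negb_or => /and3P[px py pz] /and3P[qx qy qz] dE /and3P[cx cy cz].
by apply/and3P; split; apply: (hole_swap dE); rewrite ?swapN 1?eq_sym //;
  apply: hole_in; eassumption.
Qed.

(** Conjugation: (w p)(w q)(w p) = (p q). *)
Lemma swappable_trans x y z w p q :
    w \notin [:: x; y; z] -> p \notin [:: x; y; z] -> q \notin [:: x; y; z] ->
    p != q ->
  swappable x y z w p -> swappable x y z w q -> swappable x y z p q.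
Proof.
move=> wF pF qF pq wp wq.
have [pw|pw] := eqVneq p w; first by rewrite pw.
have [qw|qw] := eqVneq q w; first by rewrite qw; apply: swappableC.
move=> c cF.
have [d1 cd1 d1E] := wp c cF; have d1F := holes3_swap wF pF d1E cF.
have [d2 cd2 d2E] := wq d1 d1F; have d2F := holes3_swap wF qF d2E d1F.
have [d3 cd3 d3E] := wp d2 d2F.
exists d3; first exact: connect_trans cd1 (connect_trans cd2 cd3).
by move=> i; rewrite d3E d2E d1E swap_conj.
Qed.

(** The transpositions that move a fixed [w] generate the symmetric group.  The
    induction exchanges, at each step, a misplaced tile with the content of its
    target, which puts that tile in place and displaces no well placed one. *)
Lemma connect_agree (U : pred hexagon) x y z w :
    w \notin [:: x; y; z] ->
    (forall p, U p -> p \notin [:: x; y; z] -> swappable x y z w p) ->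
  forall c c', holes3 c x y z -> holes3 c' x y z -> agree_off U c c' ->
    connect (@puz B h) c c'.
Proof.
move=> wF wU c c' cF c'F.
have posF d i : holes3 d x y z -> pos d i \notin [:: x; y; z].
  by move=> /and3P[dx dy dz]; rewrite !inE; apply/negP => /or3P[] /eqP e;
     move: dx dy dz; rewrite -e hole_pos.
have [n] := ubnP #|[pred i | pos c i != pos c' i]|.
elim: n => // n IHn in c cF *; rewrite ltnS => le_n cc'.
have [/existsP[i ne]|/existsPn eq_cc'] := boolP [exists i, pos c i != pos c' i];
  last by rewrite (pos_ext (c := c) (d := c')) // => i; apply/eqP/negPn/eq_cc'.
have [e|[Ui U'i]] := cc' i; first by rewrite e eqxx in ne.
have iF := posF c i cF; have i'F := posF c' i c'F.
have [d cd dE] : exists2 d, connect (@puz B h) c d &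
    forall j, pos d j = swap (pos c i) (pos c' i) (pos c j).
  by apply: (swappable_trans wF iF i'F ne) cF; apply: wU.
apply: connect_trans cd (IHn d _ _ _).
- exact: holes3_swap dE cF.
- apply: leq_trans le_n; apply/proper_card/properP; split.
    apply/fintype.subsetP => j; rewrite !inE; apply: contraNneq => cj.
    have ji : j != i by apply: contraNneq ne => <-; rewrite cj.
    rewrite dE swapN ?cj //; last by rewrite (inj_eq (@pos_inj c')).
    by rewrite -cj (inj_eq (@pos_inj c)).
  by exists i; rewrite !inE // dE swapL eqxx.
apply: agree_off_trans (cc'); apply/agree_off_sym.
exact: agree_off_swap dE.
Qed.
End Configurations.

(** * Walking and rolling through a region *)

Definition face_in (U : pred hexagon) x y z :=
  [&& face x y z, U x, U y & U z].

Lemma face_inC U x y z : face_in U x y z = face_in U y x z.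
Proof. by rewrite /face_in faceC; congr (_ && _); rewrite andbCA. Qed.

Lemma face_in_rot U x y z : face_in U x y z = face_in U y z x.
Proof. by rewrite /face_in face_rot; congr (_ && _); rewrite andbC -andbA. Qed.

(** The moves of a pair of holes: one end of the edge (a, b) goes to the third
    corner [t] of a triangle on that edge. *)
Inductive walk (U : pred hexagon) x y : hexagon -> hexagon -> Prop :=
| walk_nil : walk U x y x y
| walk_left a b t : walk U x y a b -> face_in U a b t -> walk U x y t b
| walk_right a b t : walk U x y a b -> face_in U a b t -> walk U x y a t.

Lemma walk_trans U x y a b a' b' :
  walk U x y a b -> walk U a b a' b' -> walk U x y a' b'.
Proof.
by move=> xa; elim=> // c d t _ xc cdt; [apply: walk_left xc cdt|apply: walk_right xc cdt].
Qed.

Lemma walk_sub (U V : pred hexagon) x y a b :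
  (forall p, U p -> V p) -> walk U x y a b -> walk V x y a b.
Proof.
move=> UV; have UVf p q r : face_in U p q r -> face_in V p q r.
  by case/and4P=> ? /UV ? /UV ? /UV ?; apply/and4P.
by elim=> [|c d t _ xc /UVf cdt|c d t _ xc /UVf cdt];
  [apply: walk_nil|apply: walk_left xc cdt|apply: walk_right xc cdt].
Qed.

Lemma walk_sym U x y a b : walk U x y a b -> walk U a b x y.
Proof.
elim=> [|a' b' t _ xa abt|a' b' t _ xa abt]; first exact: walk_nil.
  by apply: walk_trans xa; apply: walk_left (walk_nil _ _ _) _; rewrite face_in_rot face_inC.
by apply: walk_trans xa; apply: walk_right (walk_nil _ _ _) _;
  rewrite face_in_rot face_inC -face_in_rot.
Qed.

Definition edge_connected (U : pred hexagon) := forall x y z x' y' z',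
  face_in U x y z -> face_in U x' y' z' -> walk U x y x' y'.

Definition in_faces (U : pred hexagon) :=
  forall x, U x -> exists y z, face_in U x y z.

Section FlexibleRegions.
Variables (B : board) (h : nat).
Implicit Types (c d : configuration B h) (p q x y z w : hexagon).

(** A triangle of holes rolls over its edge xy: the tile at [w] goes first to [x],
    then to [z], each time with [y] as the auxiliary hole. *)
Lemma roll (U : pred hexagon) c x y z w : (forall p, U p -> p \in B) ->
  face_in U x y z -> face_in U x y w -> holes3 c x y z ->
  exists2 d, connect (@puz B h) c d & holes3 d x y w /\ agree_off U c d.
Proof.
move=> UB xyz xyw cF; have [ez|wz] := eqVneq w z.
  by exists c => //; rewrite ez; split=> //; apply: agree_off_refl.
have /and4P[fz Ux Uy Uz] := xyz; have /and4P[fw _ _ Uw] := xyw.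
have /and3P[cx cy cz] := cF.
have /and3P[/adjacent_neq xy /adjacent_neq yz /adjacent_neq xz] := fz.
have /and3P[_ /adjacent_neq yw /adjacent_neq xw] := fw.
have [d1 cd1 d1E] : exists2 d, connect (@puz B h) c d &
    forall i, pos d i = swap w x (pos c i).
  by apply: (slide_swap (z := y)); rewrite ?UB // face_rot.
have d1w : hole d1 w by apply: (hole_swap d1E); rewrite ?UB // swapL.
have d1y : hole d1 y by apply: (hole_swap d1E); rewrite ?UB // swapN 1?[y == x]eq_sym.
have d1z : hole d1 z by apply: (hole_swap d1E); rewrite ?UB // swapN // eq_sym.
have [d2 cd2 d2E] : exists2 d, connect (@puz B h) d1 d &
    forall i, pos d i = swap x z (pos d1 i).
  by apply: (slide_swap (z := y)); rewrite ?UB // face_rot faceC -face_rot.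
exists d2; first exact: connect_trans cd1 cd2.
split; last first.
  by apply: agree_off_trans (agree_off_swap _ _ d1E) (agree_off_swap _ _ d2E).
apply/and3P; split; apply: (hole_swap d2E); rewrite ?UB //.
- by rewrite swapL.
- by rewrite swapN 1?[y == x]eq_sym.
- by rewrite swapN 1?[w == x]eq_sym.
Qed.

Lemma walk_holes3 (U : pred hexagon) c x y z a b e :
    (forall p, U p -> p \in B) -> walk U x y a b ->
    face_in U x y z -> face_in U a b e -> holes3 c x y z ->
  exists2 d, connect (@puz B h) c d & holes3 d a b e /\ agree_off U c d.
Proof.
move=> UB W xyz abe cF; elim: W e abe => [|a' b' t _ IH abt|a' b' t _ IH abt] e abe.
- exact: roll cF.
- have [d cd [dF ad]] := IH t abt.
  have [||d' dd' [d'F ad']] := roll (c := d) (z := a') UB _ abe.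
  - by rewrite face_in_rot face_inC.
  - by move: dF; rewrite /holes3; case: hole; case: hole; case: hole.
  by exists d'; [apply: connect_trans cd dd'|split=> //; apply: agree_off_trans ad ad'].
- have [d cd [dF ad]] := IH t abt.
  have [||d' dd' [d'F ad']] := roll (c := d) (z := b') UB _ abe.
  - by rewrite face_in_rot face_in_rot face_inC.
  - by move: dF; rewrite /holes3; case: hole; case: hole; case: hole.
  by exists d'; [apply: connect_trans cd dd'|split=> //; apply: agree_off_trans ad ad'].
Qed.

(** The links between the triangles are part of the notion because it is through
    them that holes are carried to the place where two regions overlap. *)
Definition flexible (U : pred hexagon) :=
  [/\ edge_connected U, in_faces U &
      forall x y z c c', face_in U x y z ->
        holes3 c x y z -> holes3 c' x y z -> agree_off U c c' ->
        connect (@puz B h) c c'].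

(** Rolling the holes to the triangle [x0 y0 z0] and back reduces everything to
    that one position of the holes. *)
Lemma flexible_of_star (U : pred hexagon) x0 y0 z0 w :
    (forall p, U p -> p \in B) -> edge_connected U -> in_faces U ->
    face_in U x0 y0 z0 -> w \notin [:: x0; y0; z0] ->
    (forall p, U p -> p \notin [:: x0; y0; z0] ->
       @swappable B h x0 y0 z0 w p) ->
  flexible U.
Proof.
move=> UB Uconn Uf F0 wF star; split=> // x y z c c' F cF c'F cc'.
have W := Uconn _ _ _ _ _ _ F F0.
have [d cd [dF ad]] := walk_holes3 UB W F F0 cF.
have [d' cd' [d'F ad']] := walk_holes3 UB W F F0 c'F.
apply: connect_trans cd _; rewrite puz_sym; apply: connect_trans cd' _.
apply: connect_agree wF star _ _ d'F dF _.
by apply: agree_off_trans (agree_off_sym ad') _; apply: agree_off_trans (agree_off_sym cc') ad.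
Qed.

(** The separation hypothesis says that hexagons of [U] outside [U1] have all
    their neighbours in [U2], so that no triangle of [U] straddles the two
    regions. *)
Lemma flexible_union (U1 U2 U : pred hexagon) x0 y0 z0 w :
    (forall p, U p -> p \in B) ->
    (forall p, U p = U1 p || U2 p) ->
    (forall p q, U p -> ~~ U1 p -> U q -> adjacent p q -> U2 q) ->
    face x0 y0 z0 -> w \notin [:: x0; y0; z0] ->
    all (predI U1 U2) [:: x0; y0; z0; w] ->
  flexible U1 -> flexible U2 -> flexible U.
Proof.
move=> UB UE sep F0 wF /and5P[/andP[x1 x2] /andP[y1 y2] /andP[z1 z2] /andP[w1 w2] _].
move=> [conn1 f1 g1] [conn2 f2 g2].
have sub1 p : U1 p -> U p by rewrite UE => ->.
have sub2 p : U2 p -> U p by rewrite UE orbC => ->.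
have F1 : face_in U1 x0 y0 z0 by apply/and4P.
have F2 : face_in U2 x0 y0 z0 by apply/and4P.
have cover x y z : face_in U x y z -> face_in U1 x y z \/ face_in U2 x y z.
  case/and4P=> xyz Ux Uy Uz; rewrite /face_in xyz /=.
  have /and3P[xy yz xz] := xyz.
  case: (boolP (U1 x)) => nx; last first.
    right; rewrite (sep x y) // (sep x z) //.
    by move: Ux; rewrite UE (negPf nx) => /= ->.
  case: (boolP (U1 y)) => ny; last first.
    right; rewrite (sep y x) // 1?adjacentC // (sep y z) //.
    by move: Uy; rewrite UE (negPf ny) => /= ->.
  case: (boolP (U1 z)) => nz; [by left|right].
  rewrite (sep z x) // 1?adjacentC // (sep z y) // 1?adjacentC //.
  by move: Uz; rewrite UE (negPf nz) => /= ->.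
apply: (flexible_of_star UB _ _ (x0 := x0) (y0 := y0) (z0 := z0) (w := w)) => //.
- move=> x y z x' y' z' /cover F /cover F'.
  apply: (@walk_trans _ _ _ x0 y0).
    by case: F => F; [apply: walk_sub (conn1 _ _ _ _ _ _ F F1)
                     |apply: walk_sub (conn2 _ _ _ _ _ _ F F2)].
  by case: F' => F'; [apply: walk_sub (conn1 _ _ _ _ _ _ F1 F')
                   |apply: walk_sub (conn2 _ _ _ _ _ _ F2 F')].
- move=> x; rewrite UE => /orP[/f1|/f2] [y [z /and4P[F Ux Uy Uz]]];
  by exists y, z; apply/and4P; split; rewrite // UE ?Ux ?Uy ?Uz ?orbT.
- by apply/and4P; split; rewrite // UE ?x1 ?y1 ?z1.
move=> p Up pF c cF.
have [d dE] := swap_config c (UB w (sub1 w w1)) (UB p Up).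
exists d => //; have dF := holes3_swap wF pF dE cF.
move: Up; rewrite UE => /orP[U1p|U2p].
  by apply: g1 F1 cF dF _; apply: agree_off_swap dE.
by apply: g2 F2 cF dF _; apply: agree_off_swap dE.
Qed.
End FlexibleRegions.

(** * The rhombus of nine hexagons *)

(** The hexagons (i, j) with i, j < 3 are numbered k = i + 3j. *)
Definition cell (k : nat) : hexagon := (Posz (k %% 3), Posz (k %/ 3)).

Lemma cell_inj : injective cell.
Proof. by move=> k l [km kd]; rewrite (divn_eq k 3) (divn_eq l 3) km kd. Qed.

Definition cell_face k l m := face (cell k) (cell l) (cell m).

Definition swapn (k l j : nat) := if j == k then l else if j == l then k else j.

(** A word lists slides (p, q) of the content of [p] into the hole [q], and [H]
    holds the current holes.  A hole is allowed at [p], in accordance with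
    [slide_swap]. *)
Fixpoint legal (w : seq (nat * nat)) (H : seq nat) : bool :=
  if w is (p, q) :: w' then
    [&& p < 9, q < 9, q \in H, has (cell_face p q) H & legal w' (map (swapn p q) H)]
  else true.

Definition push (w : seq (nat * nat)) (k : nat) :=
  foldl (fun j m => swapn m.1 m.2 j) k w.

(** The triangle of holes at which the exchanges below are performed; it contains
    the centre 4 of the rhombus. *)
Definition hub := [:: 1; 4; 5].

(** Where [w] sends the three holes is left open: holes are not labelled. *)
Definition exchanges w k l := [&& legal w hub, k < 9, l < 9 &
  all (fun j => push w j == swapn k l j) [:: 0; 2; 3; 6; 7; 8]].

(** [turns] and [turnable] compute the walks of a pair of holes in the rhombus. *)
Definition turns (e : nat * nat) : seq (nat * nat) :=
  flatten [seq [:: (t, e.2); (e.1, t)] | t <- iota 0 9 & cell_face e.1 e.2 t].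

Definition turnable n e := iter n (fun s => undup (s ++ flatten (map turns s))) [:: e].

Definition rhombus_edges := [seq e <- [seq (k, l) | k <- iota 0 9, l <- iota 0 9] |
  has (cell_face e.1 e.2) (iota 0 9)].

(** Eight steps of breadth-first search from the edge (1, 4) of the hub exhaust
    the rhombus. *)
Lemma rhombus_edges_turnable :
  all (fun e => e \in turnable 8 (1, 4)) rhombus_edges.
Proof. by vm_compute. Qed.

(** Shortest sequences of slides from the hub that exchange two tiles and restore
    all others.  As edges, the five pairs 02, 28, 23, 36 and 67 form a tree on the
    six tiles 0, 2, 3, 6, 7, 8, so these transpositions generate all
    permutations. *)
Definition word02 := [:: (0,1); (3,0); (7,3); (8,7); (1,4); (2,1);
  (4,5); (7,8); (3,7); (0,3); (1,0); (5,2)].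
Definition word23 := [:: (0,1); (3,0); (7,3); (1,5); (0,1); (3,0); (8,4); (4,3); (5,4); (4,7); (1,4); (2,1);
  (4,5); (7,8); (3,7); (0,3); (1,0); (5,2); (8,4); (4,1); (7,8); (3,7); (0,3); (1,0)].
Definition word28 := [:: (2,1); (8,5); (7,8); (3,7); (0,3); (1,4); (5,2);
  (4,5); (3,0); (7,3); (8,7); (5,8)].
Definition word36 := [:: (0,1); (3,0); (8,5); (7,8); (6,7); (0,3); (1,0); (5,1); (8,5); (7,4); (3,6); (4,3);
  (5,4); (4,7); (1,4); (4,8)].
Definition word67 := [:: (0,1); (3,0); (1,5); (0,1); (7,4); (6,7); (4,3); (1,0); (5,1); (8,5); (7,4); (3,6);
  (4,7); (0,3); (1,0); (5,8)].

Lemma rhombus_exchanges : [/\ exchanges word02 0 2, exchanges word28 2 8, exchanges word23 2 3,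
  exchanges word36 3 6 & exchanges word67 6 7].
Proof. by vm_compute. Qed.

(** Lattice isometries place the rhombus anywhere, in all its orientations. *)
Definition adjacency_iso (f g : hexagon -> hexagon) :=
  [/\ cancel f g, cancel g f & forall x y, adjacent (f x) (f y) = adjacent x y].

(** The parallelogram is given through the coordinates [g] in which it is
    upright. *)
Definition rhomboid (g : hexagon -> hexagon) (m n : nat) : pred hexagon :=
  fun x => ((0 <= (g x).1 <= m%:Z) && (0 <= (g x).2 <= n%:Z))%R.

Section Rhombus.
Variables (B : board) (h : nat) (f g : hexagon -> hexagon).
Hypothesis fg : adjacency_iso f g.
Hypothesis rhB : forall x, rhomboid g 2 2 x -> x \in B.

Let emb k := f (cell k).

Lemma emb_inj : injective emb.
Proof. by have [fK _ _] := fg; move=> k l /(can_inj fK) /cell_inj. Qed.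

Lemma emb_face k l m : face (emb k) (emb l) (emb m) = cell_face k l m.
Proof. by have [_ _ adj] := fg; rewrite /face !adj. Qed.

Lemma rhombusP x : reflect (exists2 k, k < 9 & x = emb k) (rhomboid g 2 2 x).
Proof.
have [fK gK _] := fg; rewrite /rhomboid; apply: (iffP idP) => [|[k k9 ->]]; last first.
  by rewrite fK /=; lia.
move=> H; exists (`|(g x).1| + `|(g x).2| * 3)%N; first lia.
rewrite /emb /cell -[LHS]gK; congr f; move: H; case: (g x) => a b /= H.
by congr pair; lia.
Qed.

Lemma emb_in k : k < 9 -> rhomboid g 2 2 (emb k).
Proof. by move=> k9; apply/rhombusP; exists k. Qed.

Lemma swap_emb p q k : swap (emb p) (emb q) (emb k) = emb (swapn p q k).
Proof. by rewrite /swap /swapn !(inj_eq emb_inj); case: ifP => // _; case: ifP. Qed.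

Definition push_swaps (w : seq (nat * nat)) x := foldl (fun x m => swap (emb m.1) (emb m.2) x) x w.

Lemma push_swaps_emb w k : push_swaps w (emb k) = emb (push w k).
Proof. by elim: w k => //= m w IH k; rewrite -[push_swaps _ _]/(push_swaps w _) swap_emb IH. Qed.

Lemma push_swaps_out w H x : legal w H -> ~~ rhomboid g 2 2 x -> push_swaps w x = x.
Proof.
move=> + nx; elim: w H => //= -[p q] w IH H /and5P[p9 q9 _ _ /IH {}IH] /=.
by rewrite -[push_swaps _ _]/(push_swaps w _) swapN ?IH //; apply: contraNneq nx => ->; apply: emb_in.
Qed.

(** A legal word is carried out by slides whatever the tiles are, so checking it
    once on the numbered rhombus serves all its images in all boards. *)
Lemma legal_connect w H (c : configuration B h) :
  legal w H -> all (fun k => hole c (emb k)) H ->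
  exists2 d, connect (@puz B h) c d & forall i, pos d i = push_swaps w (pos c i).
Proof.
elim: w H c => [|[p q] w IH] H c /=; first by exists c.
case/and5P=> p9 q9 qH /hasP[r rH pqr] wH cH.
have [d cd dE] : exists2 d, connect (@puz B h) c d &
    forall i, pos d i = swap (emb p) (emb q) (pos c i).
  by apply: (slide_swap (z := emb r)); rewrite ?emb_face ?rhB ?emb_in ?(allP cH).
have [|d' dd' d'E] := IH _ d wH.
  rewrite all_map; apply/allP => k kH /=; have ck := allP cH k kH.
  apply: (hole_swap dE); rewrite -swap_emb ?swapK //.
  rewrite /swap; case: eqP => _; first by apply: rhB; apply: emb_in.
  by case: eqP => _; [apply: rhB; apply: emb_in|apply: hole_in ck].
by exists d' => [|i]; [apply: connect_trans cd dd'|rewrite d'E dE].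
Qed.

Lemma exchanges_swappable w k l : exchanges w k l ->
  @swappable B h (emb 1) (emb 4) (emb 5) (emb k) (emb l).
Proof.
case/and4P=> wH k9 l9 wE c cF; have [|d cd dE] := legal_connect wH (c := c).
  by move: cF => /and3P[c1 c4 c5]; rewrite /= c1 c4 c5.
exists d => // i; rewrite dE.
have [/rhombusP[j j9 cj]|nR] := boolP (rhomboid g 2 2 (pos c i)); last first.
  rewrite (push_swaps_out wH) // swapN //; apply: contraNneq nR => ->; exact: emb_in.
rewrite cj push_swaps_emb swap_emb; congr emb; apply/eqP; apply: (allP wE).
move: cF => /and3P[]; move: (hole_pos c i); rewrite cj.
by move: j9 {cj}; do 9 (case: j => [|j] //=; try by move=> _ -> //).
Qed.

Lemma turnable_walk n a b : a < 9 -> b < 9 -> {in turnable n (a, b), forall q,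
  [/\ q.1 < 9, q.2 < 9 & walk (rhomboid g 2 2) (emb a) (emb b) (emb q.1) (emb q.2)]}.
Proof.
move=> a9 b9; elim: n => [|n IH] q; first by rewrite inE => /eqP->; split=> //; apply: walk_nil.
rewrite [turnable _ _]iterS mem_undup mem_cat => /orP[/IH //|].
case/flattenP=> s /mapP[p /IH[p1 p2 W] ->] /flattenP[s'].
case/mapP=> t; rewrite mem_filter mem_iota => /andP[pt t9] ->.
have F : face_in (rhomboid g 2 2) (emb p.1) (emb p.2) (emb t).
  by rewrite /face_in emb_face pt !emb_in.
rewrite !inE => /orP[]/eqP-> /=; split=> //.
  exact: walk_left W F.
exact: walk_right W F.
Qed.

Lemma rhombus_edge_connected : edge_connected (rhomboid g 2 2).
Proof.
have edgeP x y z : face_in (rhomboid g 2 2) x y z ->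
    exists a b, [/\ x = emb a, y = emb b & (a, b) \in rhombus_edges].
  case/and4P=> abt /rhombusP[a a9 ea] /rhombusP[b b9 eb] /rhombusP[t t9 et].
  subst x y z; rewrite emb_face in abt.
  exists a, b; split=> //.
  rewrite mem_filter; apply/andP; split; first by apply/hasP; exists t; rewrite ?mem_iota.
  by apply/allpairsP; exists (a, b); rewrite !mem_iota.
have hub_walk a b : (a, b) \in rhombus_edges ->
    walk (rhomboid g 2 2) (emb 1) (emb 4) (emb a) (emb b).
  move=> ab; have tab : (a, b) \in turnable 8 (1, 4) by apply: (allP rhombus_edges_turnable).
  by have [] := @turnable_walk 8 1 4 isT isT (a, b) tab.
move=> x y z x' y' z' /edgeP[a [b [-> -> ab]]] /edgeP[a' [b' [-> -> ab']]].
exact: walk_trans (walk_sym (hub_walk _ _ ab)) (hub_walk _ _ ab').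
Qed.

Lemma rhombus_in_faces : in_faces (rhomboid g 2 2).
Proof.
move=> x /rhombusP[k k9 ->].
have /hasP[l + /hasP[m +]] : has (fun l => has (cell_face k l) (iota 0 9)) (iota 0 9).
  by move: k9; do 9 (case: k => [|k] //).
rewrite !mem_iota => l9 m9 klm.
by exists (emb l), (emb m); rewrite /face_in emb_face klm !emb_in.
Qed.

Lemma flexible_rhombus : flexible B h (rhomboid g 2 2).
Proof.
have [/exchanges_swappable s02 /exchanges_swappable s28 /exchanges_swappable s23
      /exchanges_swappable s36 /exchanges_swappable s67] := rhombus_exchanges.
have F k l m : k \notin [:: l; m; 5] -> emb k \notin [:: emb l; emb m; emb 5].
  by rewrite !inE !(inj_eq emb_inj).
have N k l : k != l -> emb k != emb l by rewrite (inj_eq emb_inj).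
have s26 : @swappable B h (emb 1) (emb 4) (emb 5) (emb 2) (emb 6).
  by apply: (swappable_trans _ _ _ _ (swappableC s23)) s36; rewrite ?F ?N.
have s27 : @swappable B h (emb 1) (emb 4) (emb 5) (emb 2) (emb 7).
  by apply: (swappable_trans _ _ _ _ (swappableC s26)) s67; rewrite ?F ?N.
apply: (flexible_of_star (x0 := emb 1) (y0 := emb 4) (z0 := emb 5) (w := emb 2)) => //.
- exact: rhombus_edge_connected.
- exact: rhombus_in_faces.
- by rewrite /face_in emb_face !emb_in.
- exact: F.
move=> p /rhombusP[k k9 ->] kF.
have : k \notin hub by apply: contra kF; rewrite !inE !(inj_eq emb_inj).
have s20 := swappableC s02.
have s22 : @swappable B h (emb 1) (emb 4) (emb 5) (emb 2) (emb 2).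
  by move=> c _; exists c => // i; rewrite /swap; case: eqP.
move: k9 {kF}; do 9 (case: k => [|k] //).
Qed.
End Rhombus.

(** * Assembling the boards from rhombi *)

Lemma adjacency_iso_shift f g a b : adjacency_iso f g ->
  adjacency_iso (fun y => f (y.1 + a, y.2 + b)%R) (fun x => ((g x).1 - a, (g x).2 - b)%R).
Proof.
case=> fK gK adj; split=> [[y1 y2]|x|x y] /=.
- by rewrite fK /= !addrK.
- by rewrite !subrK -[RHS]gK; case: (g x).
by rewrite adj !adjacentE; case: x y => [x1 x2] [y1 y2]; rewrite !xpair_eqE /=; lia.
Qed.

Lemma adjacency_isoV f g x y : adjacency_iso f g -> adjacent x y = adjacent (g x) (g y).
Proof. by case=> _ gK adj; rewrite -[RHS]adj !gK. Qed.

Section Shapes.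
Variables (B : board) (h : nat).
Implicit Types (x y z w p q : hexagon).

(** A parallelogram longer by one is the union of the shorter one and of its
    translate by one step; these overlap in at least two rows of three, which
    hold a triangle and a further hexagon. *)
Lemma flexible_rhomboid f g m n : adjacency_iso f g -> 2 <= m -> 2 <= n ->
  (forall x, rhomboid g m n x -> x \in B) -> flexible B h (rhomboid g m n).
Proof.
move=> fg /subnKC <- /subnKC <-; move: (m - 2) (n - 2) => {}m {}n.
elim: m n f g fg => [|m IHm] n f g fg; first elim: n f g fg => [|n IHn] f g fg.
- exact: flexible_rhombus fg.
- move=> UB; have [fK gK adj] := fg; have fg' := adjacency_iso_shift 0 1 fg.
  have U2B : forall x, rhomboid (fun x => ((g x).1 - 0, (g x).2 - 1)%R) 2 (2 + n) x -> x \in B.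
    by move=> x H; apply: UB; move: H; rewrite /rhomboid /=; lia.
  have U1B : forall x, rhomboid g 2 (2 + n) x -> x \in B.
    by move=> x H; apply: UB; move: H; rewrite /rhomboid /=; lia.
  have G1 := IHn _ _ fg U1B; have G2 := IHn _ _ fg' U2B.
  apply: (flexible_union UB _ _ (x0 := f (0, 1)%R) (y0 := f (1, 1)%R)
           (z0 := f (1, 2)%R) (w := f (0, 2)%R) _ _ _ G1 G2).
  + by move=> p; rewrite /rhomboid /=; lia.
  + move=> p q; rewrite (adjacency_isoV _ _ fg) adjacentE /rhomboid /=; lia.
  + by rewrite /face !adj.
  + by rewrite !inE !(can_eq fK).
  by rewrite /= /rhomboid !fK /=; lia.
move=> UB; have [fK gK adj] := fg; have fg' := adjacency_iso_shift 1 0 fg.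
have U2B : forall x, rhomboid (fun x => ((g x).1 - 1, (g x).2 - 0)%R) (2 + m) (2 + n) x -> x \in B.
  by move=> x H; apply: UB; move: H; rewrite /rhomboid /=; lia.
have U1B : forall x, rhomboid g (2 + m) (2 + n) x -> x \in B.
  by move=> x H; apply: UB; move: H; rewrite /rhomboid /=; lia.
have G1 := IHm _ _ _ fg U1B; have G2 := IHm _ _ _ fg' U2B.
apply: (flexible_union UB _ _ (x0 := f (1, 0)%R) (y0 := f (2, 0)%R)
         (z0 := f (2, 1)%R) (w := f (1, 1)%R) _ _ _ G1 G2).
+ by move=> p; rewrite /rhomboid /=; lia.
+ move=> p q; rewrite (adjacency_isoV _ _ fg) adjacentE /rhomboid /=; lia.
+ by rewrite /face !adj.
+ by rewrite !inE !(can_eq fK).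
by rewrite /= /rhomboid !fK /=; lia.
Qed.

Definition trapezoid_at (b n : nat) : pred hexagon := fun x =>
  ([&& b%:Z <= x.2, x.2 <= b%:Z + 2, x.2 <= x.1 & x.1 <= b%:Z + n%:Z])%R.

(** The translation along (1, 1) lets an induction on [n] pass from the board to
    the smaller triangle above its lowest row. *)
Definition triangle_at (b n : nat) : pred hexagon := fun x =>
  ([&& b%:Z <= x.2, x.2 <= x.1 & x.1 <= b%:Z + n%:Z])%R.

(** The strip is covered by two parallelograms, one parallel to its left side and
    one parallel to its right side. *)
Lemma flexible_trapezoid b n : 4 <= n -> (forall x, trapezoid_at b n x -> x \in B) ->
  flexible B h (trapezoid_at b n).
Proof.
move=> n4 UB; pose N := n - 2.
have isoA : adjacency_iso (fun y => (y.1 + b%:Z - y.2 + N%:Z, y.1 + b%:Z)%R)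
                          (fun x => (x.2 - b%:Z, x.2 - x.1 + N%:Z)%R).
  split=> [[y1 y2]|[x1 x2]|[x1 x2] [y1 y2]] /=; [congr pair; lia..|].
  by rewrite !adjacentE !xpair_eqE /=; lia.
have isoB : adjacency_iso (fun y => (y.1 + (b%:Z + 2), y.2 + b%:Z)%R)
                          (fun x => (x.1 - (b%:Z + 2), x.2 - b%:Z)%R).
  split=> [[y1 y2]|[x1 x2]|[x1 x2] [y1 y2]] /=; [congr pair; lia..|].
  by rewrite !adjacentE !xpair_eqE /=; lia.
have N2 : 2 <= N by lia.
have GA := flexible_rhomboid isoA (isT : 2 <= 2) N2 _.
have GB := flexible_rhomboid isoB N2 (isT : 2 <= 2) _.
apply: (flexible_union UB _ _ (x0 := (b%:Z + 2, b%:Z)%R) (y0 := (b%:Z + 2, b%:Z + 1)%R)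
    (z0 := (b%:Z + 3, b%:Z + 1)%R) (w := (b%:Z + 2, b%:Z + 2)%R) _ _ _ (GA _) (GB _)).
- by case=> x1 x2; rewrite /rhomboid /trapezoid_at /=; lia.
- case=> x1 x2 [y1 y2]; rewrite adjacentE /rhomboid /trapezoid_at /=; lia.
- by rewrite /face !adjacentE !xpair_eqE /=; lia.
- by rewrite !inE !xpair_eqE; lia.
- by rewrite /= /rhomboid /=; lia.
- by case=> x1 x2 H; apply: UB; move: H; rewrite /rhomboid /trapezoid_at /=; lia.
- by case=> x1 x2 H; apply: UB; move: H; rewrite /rhomboid /trapezoid_at /=; lia.
Qed.

(** The three lowest rows and the smaller triangle above the first row overlap in
    two rows.  For the smallest case [n = 4], whose upper triangle is too small,
    the rows are completed by the rhombus at the top corner. *)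
Lemma flexible_triangle b n : 4 <= n -> (forall x, triangle_at b n x -> x \in B) ->
  flexible B h (triangle_at b n).
Proof.
move=> /subnKC <-; elim: (n - 4) b => {n} [|n IH] b UB.
- have isoC : adjacency_iso (fun y => (y.1 + (b%:Z + 2), y.1 + (b%:Z + 2) - y.2)%R)
                            (fun x => (x.1 - (b%:Z + 2), x.1 - x.2)%R).
    split=> [[y1 y2]|[x1 x2]|[x1 x2] [y1 y2]] /=; [congr pair; lia..|].
    by rewrite !adjacentE !xpair_eqE /=; lia.
  have GA := @flexible_trapezoid b 4 isT _.
  have GC := flexible_rhomboid isoC (isT : 2 <= 2) (isT : 2 <= 2) _.
  apply: (flexible_union UB _ _ (x0 := (b%:Z + 2, b%:Z)%R) (y0 := (b%:Z + 2, b%:Z + 1)%R)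
    (z0 := (b%:Z + 3, b%:Z + 1)%R) (w := (b%:Z + 2, b%:Z + 2)%R) _ _ _ (GA _) (GC _)).
  + by case=> x1 x2; rewrite /rhomboid /trapezoid_at /triangle_at /=; lia.
  + case=> x1 x2 [y1 y2]; rewrite adjacentE /rhomboid /trapezoid_at /triangle_at /=; lia.
  + by rewrite /face !adjacentE !xpair_eqE /=; lia.
  + by rewrite !inE !xpair_eqE; lia.
  + by rewrite /= /rhomboid /trapezoid_at /=; lia.
  + by case=> x1 x2 H; apply: UB; move: H; rewrite /trapezoid_at /triangle_at /=; lia.
  + by case=> x1 x2 H; apply: UB; move: H; rewrite /rhomboid /triangle_at /=; lia.
have GA := @flexible_trapezoid b (4 + n.+1) isT _.
apply: (flexible_union UB _ _ (x0 := (b%:Z + 2, b%:Z + 1)%R) (y0 := (b%:Z + 2, b%:Z + 2)%R)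
    (z0 := (b%:Z + 3, b%:Z + 2)%R) (w := (b%:Z + 3, b%:Z + 1)%R) _ _ _ (GA _) (IH b.+1 _)).
- by case=> x1 x2; rewrite /trapezoid_at /triangle_at /=; lia.
- case=> x1 x2 [y1 y2]; rewrite adjacentE /trapezoid_at /triangle_at /=; lia.
- by rewrite /face !adjacentE !xpair_eqE /=; lia.
- by rewrite !inE !xpair_eqE; lia.
- by rewrite /= /trapezoid_at /triangle_at /=; lia.
- by case=> x1 x2 H; apply: UB; move: H; rewrite /trapezoid_at /triangle_at /=; lia.
- by case=> x1 x2 H; apply: UB; move: H; rewrite /triangle_at /=; lia.
Qed.

(** The ball of radius [n] for the hexagonal distance. *)
Definition hexdisk (n : nat) : pred hexagon := fun x =>
  ([&& `|x.1| <= n%:Z, `|x.2| <= n%:Z & `|x.1 - x.2| <= n%:Z])%R.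

(** Two neighbouring sectors of 120 degrees, each a parallelogram with a corner at
    the centre, overlap in a sector of 60 degrees and make up a half disk.  Two
    complementary half disks share only a line, which contains no triangle; so a
    third half disk is placed across them. *)
Lemma flexible_hexdisk n : 2 <= n -> (forall x, hexdisk n x -> x \in B) ->
  flexible B h (hexdisk n).
Proof.
move=> n2 UB; pose N := (n%:Z)%R.
have iso1 : adjacency_iso id id by [].
have iso2 : adjacency_iso (fun y => (y.1 - y.2, y.1)%R) (fun x => (x.2, x.2 - x.1)%R).
  split=> [[y1 y2]|[x1 x2]|[x1 x2] [y1 y2]] /=; [congr pair; lia..|].
  by rewrite !adjacentE !xpair_eqE /=; lia.
have iso3 : adjacency_iso (fun y => (y.1, y.1 - y.2)%R) (fun x => (x.1, x.1 - x.2)%R).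
  split=> [[y1 y2]|[x1 x2]|[x1 x2] [y1 y2]] /=; [congr pair; lia..|].
  by rewrite !adjacentE !xpair_eqE /=; lia.
have iso4 := adjacency_iso_shift (- N) (- N) iso1.
have iso5 := adjacency_iso_shift (- N) (- N) iso2.
have G1 : flexible B h (fun x => hexdisk n x && (0 <= x.2)%R).
  apply: (flexible_union _ _ _ (x0 := (0, 0)%R) (y0 := (0, 1)%R) (z0 := (1, 1)%R) (w := (0, 2)%R)
      _ _ _ (flexible_rhomboid iso1 n2 n2 _) (flexible_rhomboid iso2 n2 n2 _)) => //.
  - by move=> x /andP[/UB].
  - by case=> x1 x2; rewrite /rhomboid /hexdisk /=; lia.
  - case=> x1 x2 [y1 y2]; rewrite adjacentE /rhomboid /hexdisk /=; lia.
  - by rewrite /= /rhomboid /=; lia.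
  - by case=> x1 x2 H; apply: UB; move: H; rewrite /rhomboid /hexdisk /=; lia.
  - by case=> x1 x2 H; apply: UB; move: H; rewrite /rhomboid /hexdisk /=; lia.
have G2 : flexible B h (fun x => hexdisk n x && (0 <= x.1)%R).
  apply: (flexible_union _ _ _ (x0 := (0, 0)%R) (y0 := (1, 0)%R) (z0 := (1, 1)%R) (w := (2, 0)%R)
      _ _ _ (flexible_rhomboid iso1 n2 n2 _) (flexible_rhomboid iso3 n2 n2 _)) => //.
  - by move=> x /andP[/UB].
  - by case=> x1 x2; rewrite /rhomboid /hexdisk /=; lia.
  - case=> x1 x2 [y1 y2]; rewrite adjacentE /rhomboid /hexdisk /=; lia.
  - by rewrite /= /rhomboid /=; lia.
  - by case=> x1 x2 H; apply: UB; move: H; rewrite /rhomboid /hexdisk /=; lia.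
  - by case=> x1 x2 H; apply: UB; move: H; rewrite /rhomboid /hexdisk /=; lia.
have G3 : flexible B h (fun x => hexdisk n x && (x.2 <= 0)%R).
  apply: (flexible_union _ _ _ (x0 := (0, 0)%R) (y0 := (0, -1)%R) (z0 := (-1, -1)%R) (w := (0, -2)%R)
      _ _ _ (flexible_rhomboid iso4 n2 n2 _) (flexible_rhomboid iso5 n2 n2 _)) => //.
  - by move=> x /andP[/UB].
  - by case=> x1 x2; rewrite /rhomboid /hexdisk /=; lia.
  - case=> x1 x2 [y1 y2]; rewrite adjacentE /rhomboid /hexdisk /=; lia.
  - by rewrite /= /rhomboid /=; lia.
  - by case=> x1 x2 H; apply: UB; move: H; rewrite /rhomboid /hexdisk /=; lia.
  - by case=> x1 x2 H; apply: UB; move: H; rewrite /rhomboid /hexdisk /=; lia.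
have G12 : flexible B h (fun x => hexdisk n x && ((0 <= x.2) || (0 <= x.1))%R).
  apply: (flexible_union _ _ _ (x0 := (0, 0)%R) (y0 := (1, 0)%R) (z0 := (1, 1)%R) (w := (2, 0)%R)
      _ _ _ G1 G2) => //.
  - by move=> x /andP[/UB].
  - by case=> x1 x2; rewrite /hexdisk /=; lia.
  - case=> x1 x2 [y1 y2]; rewrite adjacentE /hexdisk /=; lia.
  - by rewrite /= /hexdisk /=; lia.
apply: (flexible_union UB _ _ (x0 := (0, 0)%R) (y0 := (1, 0)%R) (z0 := (0, -1)%R) (w := (2, 0)%R)
    _ _ _ G12 G3) => //.
- by case=> x1 x2; rewrite /hexdisk /=; lia.
- case=> x1 x2 [y1 y2]; rewrite adjacentE /hexdisk /=; lia.
- by rewrite /= /hexdisk /=; lia.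
Qed.
End Shapes.

(** * Counting holes *)

Section Holes.
Variables (B : board) (h : nat).
Hypothesis hB : h <= #|` B|.
Implicit Types (c d : configuration B h).

Lemma card_holes c : #|[pred q : B | is_hole c q]| = h.
Proof.
have E : [pred q : B | is_hole c q] =i [predC codom (position c)].
  move=> q; rewrite !inE /is_hole; apply/forallP/idP => [qN|].
    by apply/negP => /codomP[i e]; move: (qN i); rewrite e eqxx.
  by move=> + i; apply: contraNneq => <-; apply: codom_f.
rewrite (eq_card E); have := cardC (mem (codom (position c))).
rewrite card_codom; last exact: position_inj.
rewrite card_ord -cardfE; move: #|[predC _]| hB => k; lia.
Qed.

Lemma config_with_holes (S : {set B}) : #|S| = h ->
  exists c, forall q, is_hole c q = (q \in S).
Proof.
move=> Sh; have tE : #|` B| - h = #|~: S| by rewrite cardsCs setCK Sh cardfE.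
pose f : {ffun tile B h -> B} := [ffun i => enum_val (cast_ord tE i)].
have inj : injectiveb f.
  by apply/injectiveP => i j; rewrite !ffunE => /enum_val_inj /cast_ord_inj.
exists (exist (fun f : {ffun tile B h -> B} => is_true (injectiveb f)) f inj) => q.
rewrite /is_hole /position /=; apply/forallP/idP => [qN|qS i]; last first.
  rewrite ffunE; apply: contraTneq qS => <-.
  by have := enum_valP (cast_ord tE i); rewrite inE.
apply: contraT => qS; have qSC : q \in ~: S by rewrite inE.
have := qN (cast_ord (esym tE) (enum_rank_in qSC q)).
by rewrite ffunE cast_ordKV enum_rankK_in // eqxx.
Qed.
End Holes.

(** * Three holes connect *)

Section Upper.
Variables (B : board) (h : nat) (U : pred hexagon).
Hypotheses (h3 : 3 <= h) (hB : h <= #|` B|).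
Hypotheses (UB : forall x, (x \in B) = U x) (gU : flexible B h U).
Implicit Types (c d : configuration B h).

(** Follow the walk with the pair of holes.  Either it steps onto a triangle whose
    third corner is the hole [s], and the three holes form a triangle, or the walk
    ends without having disturbed [s]. *)
Lemma walk_to_third_hole c x y s a b : walk U x y a b ->
    hole c x -> hole c y -> hole c s -> s != x -> s != y ->
  (exists a' b' d, [/\ face_in U a' b' s, connect (@puz B h) c d & holes3 d a' b' s]) \/
  (exists2 d, connect (@puz B h) c d & holes3 d a b s /\ (s != a) && (s != b)).
Proof.
move=> W cx cy cs sx sy.
have step d a' b' t : face_in U a' b' t -> hole d a' -> hole d b' -> hole d s ->
    s != a' -> s != b' -> s != t ->
    exists2 d', connect (@puz B h) d d' & holes3 d' t b' s.
  case/and4P=> F Ua Ub Ut da db ds sa sb st.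
  have /and3P[/adjacent_neq ab /adjacent_neq bt _] := F.
  have [d' dd' d'E] : exists2 d', connect (@puz B h) d d' &
      forall i, pos d' i = swap t a' (pos d i).
    by apply: (slide_swap (z := b')); rewrite ?UB // face_rot.
  exists d' => //; apply/and3P; split; apply: (hole_swap d'E); rewrite ?UB //.
  - by rewrite swapL.
  - by rewrite swapN // eq_sym.
  - by rewrite -UB; apply: hole_in ds.
  - by rewrite swapN.
elim: W => [|a' b' t _ IH abt|a' b' t _ IH abt].
- by right; exists c => //; rewrite sx sy; split=> //; apply/and3P.
- case: IH => [|[d cd [dabs sab]]]; first by left.
  have [est|st] := eqVneq s t.
    by left; exists a', b', d; rewrite est in dabs *.
  have /and3P[da db ds] := dabs; have /andP[sa sb] := sab.
  have [d' dd' d'F] := step d a' b' t abt da db ds sa sb st.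
  by right; exists d'; [apply: connect_trans cd dd'|rewrite sb].
case: IH => [|[d cd [dabs sab]]]; first by left.
have [est|st] := eqVneq s t.
  by left; exists a', b', d; rewrite est in dabs *.
have /and3P[da db ds] := dabs; have /andP[sa sb] := sab.
have abt' : face_in U b' a' t by rewrite face_inC.
have [d' dd' /and3P[d't d'a d's]] := step d b' a' t abt' db da ds sb sa st.
right; exists d'; first exact: connect_trans cd dd'.
by rewrite sa; split=> //; apply/and3P.
Qed.

(** The walk leads to an edge opposite to the third hole in some triangle, so the
    three holes form a triangle in either case of [walk_to_third_hole]; that
    triangle is then rolled to the prescribed one. *)
Lemma non_isolated_to_face c x0 y0 z0 : non_isolated c -> face_in U x0 y0 z0 ->
  exists2 d, connect (@puz B h) c d & holes3 d x0 y0 z0.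
Proof.
have [conn cov _] := gU.
have UB' x : U x -> x \in B by rewrite UB.
case/existsP=> i /existsP[q /and3P[cq pq /existsP[r /and4P[rq cr pr qr]]]] F0.
have [s cs /andP[sq sr]] : exists2 s, is_hole c s & (s != q) && (s != r).
  have : 0 < #|[predD1 [predD1 [pred s : B | is_hole c s] & q] & r]|.
    have := card_holes hB c; rewrite (cardD1 q) (cardD1 r) !inE cq rq cr /=.
    by move: #|_|; lia.
  by case/card_gt0P=> s; rewrite !inE => /and3P[sr sq cs]; exists s; rewrite ?sr ?sq.
have Uval (p : B) : U (val p) by rewrite -UB (valP p).
have [t [u Fs]] := cov _ (Uval s).
have Fq : face_in U (val q) (val r) (val (position c i)).
  by rewrite /face_in !Uval !andbT /face qr (adjacentC (val r)) (adjacentC (val q)) pr pq.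
have W := conn _ _ _ _ _ _ Fq (etrans (esym (face_in_rot U (val s) t u)) Fs).
rewrite !is_holeE in cq cr cs.
have [[a [b [d [F cd dF]]]]|] := walk_to_third_hole W cq cr cs sq sr.
  have [d' dd' [d'F _]] := walk_holes3 UB' (conn _ _ _ _ _ _ F F0) F F0 dF.
  by exists d' => //; apply: connect_trans cd dd'.
case=> d cd [dF _]; have F : face_in U t u (val s) by rewrite -face_in_rot.
have [d' dd' [d'F _]] := walk_holes3 UB' (conn _ _ _ _ _ _ F F0) F F0 dF.
by exists d' => //; apply: connect_trans cd dd'.
Qed.

End Upper.

Section Conn.
Variables (B : board) (U : pred hexagon).
Hypotheses (UB : forall x, (x \in B) = U x) (gU : flexible B 3 U).

(** A second triangle on the edge xy provides a tile, at [w], that can slide when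
    the holes are at [x], [y] and [z]. *)
Lemma maximally_connected3 x y z w : face_in U x y z -> face_in U x y w -> w != z ->
  maximally_connected B 3.
Proof.
move=> F Fw wz; have /and4P[f Ux Uy Uz] := F; have /and4P[fw _ _ Uw] := Fw.
have [xB yB zB wB] : [/\ x \in B, y \in B, z \in B & w \in B] by rewrite !UB.
have /and3P[xy yz xz] := f; have /and3P[_ yw xw] := fw.
have nxy := adjacent_neq xy; have nyz := adjacent_neq yz; have nxz := adjacent_neq xz.
pose S : {set B} := [set p in [:: [` xB]; [` yB]; [` zB]]%fset].
have S3 : #|S| = 3.
  rewrite cardsE; apply/card_uniqP; rewrite /= !inE -!(inj_eq val_inj) /=.
  by rewrite negb_or nxy nyz nxz.
have hB : 3 <= #|` B| by rewrite cardfE -S3 max_card.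
split.
  have [c cS] := config_with_holes S3.
  exists c.
  have cE p (pB : p \in B) : hole c p = [|| p == x, p == y | p == z].
    by rewrite -[p]/(val [` pB]%fset) -is_holeE cS !inE -!(inj_eq val_inj) /=.
  have : ~~ hole c w.
    rewrite cE // !negb_or wz andbT.
    by rewrite ![w == _]eq_sym (adjacent_neq xw) (adjacent_neq yw).
  rewrite /hole wB negb_forall => /existsP[i /negPn /eqP ci].
  apply/existsP; exists i; apply/existsP; exists [` xB]%fset; apply/and3P; split.
  - by rewrite cS !inE eqxx.
  - by rewrite -/(pos c i) ci adjacentC.
  apply/existsP; exists [` yB]%fset; rewrite -/(pos c i) ci /= (adjacentC w) yw xy.
  by rewrite -(inj_eq val_inj) /= eq_sym nxy cS !inE eqxx orbT.
move=> c c' ic ic'.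
have [d cd dF] := non_isolated_to_face (leqnn 3) hB UB gU ic F.
have [d' cd' d'F] := non_isolated_to_face (leqnn 3) hB UB gU ic' F.
have [_ _ g] := gU.
apply: connect_trans cd _; rewrite puz_sym; apply: connect_trans cd' _.
by apply: g F d'F dF _ => i; right; rewrite -!UB; split; apply: pos_in.
Qed.
End Conn.

(** * Two holes do not: the parity obstruction *)

(** The three chosen steps add up to zero, hence every triangle is cyclically
    oriented by them. *)
Definition directed (x y : hexagon) : bool :=
  ((y.1 - x.1, y.2 - x.2)%R : hexagon) \in [:: (1, 0); (0, 1); (-1, -1)]%R.

Lemma directedP x y z : face x y z -> directed x y -> directed y z /\ directed z x.
Proof.
case: x y z => [x1 x2] [y1 y2] [z1 z2].
rewrite /face !adjacentE /directed !inE !xpair_eqE /= => F.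
by case/or3P=> /andP[/eqP/(canRL (subrK _)) e1 /eqP/(canRL (subrK _)) e2];
  subst y1 y2; split; lia.
Qed.

Lemma directed_asym x y : directed x y -> directed y x = false.
Proof. by case: x y => [x1 x2] [y1 y2]; rewrite /directed !inE !xpair_eqE /=; lia. Qed.

Lemma directed_total x y : adjacent x y -> directed x y || directed y x.
Proof. by case: x y => [x1 x2] [y1 y2]; rewrite adjacentE /directed !inE !xpair_eqE /=; lia. Qed.

Lemma connect_preserves (T : finType) (e : rel T) (P : T -> Prop) x y :
  (forall a b, e a b -> P a -> P b) -> connect e x y -> P x -> P y.
Proof.
move=> eP /connectP[s]; elim: s x => [|z s IH] x /= => [_ ->|/andP[xz zs] ly Px] //.
by apply: IH zs ly _; apply: eP xz Px.
Qed.

Lemma slide_sym (B : board) h (c c' : configuration B h) : slide c c' -> slide c' c.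
Proof.
case/existsP=> i /existsP[q /and3P[/and3P[cq pq /existsP[r /and4P[rq cr pr qr]]] /eqP c'i /forallP cc']].
have c'j j : j != i -> position c' j = position c j by move=> ji; apply/eqP/(implyP (cc' j)).
apply/existsP; exists i; apply/existsP; exists (position c i); apply/and3P; split=> //.
- apply/and3P; split.
  + apply/forallP => j; have [->|ji] := eqVneq j i.
      by rewrite c'i; have := forallP cq i; rewrite eq_sym.
    by rewrite c'j // (inj_eq (@position_inj _ _ c)).
  + by rewrite c'i adjacentC.
  apply/existsP; exists r; apply/and4P; rewrite c'i; split=> //.
    by rewrite eq_sym; apply: (forallP cr).
  apply/forallP => j; have [->|ji] := eqVneq j i; first by rewrite c'i eq_sym.
  by rewrite c'j //; apply: (forallP cr).
by apply/forallP => j; apply/implyP => /c'j ->.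
Qed.

Section Parity.
Variable B : board.
Hypothesis B4 : 4 <= #|` B|.
Implicit Types c : configuration B 2.

Lemma two_holes c (x y z : B) : x != y -> is_hole c x -> is_hole c y -> is_hole c z ->
  (z == x) || (z == y).
Proof.
move=> xy cx cy cz; apply: contraT; rewrite negb_or => /andP[zx zy].
have := card_holes (ltnW (ltnW B4)) c.
by rewrite (cardD1 x) (cardD1 y) (cardD1 z) !inE cx cy cz zx zy eq_sym xy.
Qed.

(** When a tile at [p] slides into the hole [q] next to the hole [r], the ordered
    pair of holes (q, r) becomes (r, p) and (r, q) becomes (p, r).  Tiles and
    ordered holes together undergo (p q)(p r), which is even. *)
Lemma even_slides c0 (q0 r0 : B) c :
    is_hole c0 q0 -> is_hole c0 r0 -> directed (val q0) (val r0) ->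
    connect (@puz B 2) c0 c ->
  exists s : {perm B}, [/\ ~~ odd_perm s,
    forall i, position c i = s (position c0 i) & directed (val (s q0)) (val (s r0))].
Proof.
move=> hq hr dqr; pose P c := exists s : {perm B}, [/\ ~~ odd_perm s,
    forall i, position c i = s (position c0 i) & directed (val (s q0)) (val (s r0))].
have nqr : q0 != r0.
  by apply: contraTneq dqr => ->; apply/negP => /[dup] /directed_asym ->.
move=> c0c; apply: (connect_preserves (P := P) _ c0c); last first.
  by exists 1%g; rewrite odd_perm1 !perm1; split=> // i; rewrite perm1.
move=> {c c0c}c c' cc' [s [sev sE ds]].
have {cc'} : slide c c' by case/orP: cc' => // /slide_sym.
case/existsP=> i /existsP[q /and3P[/and3P[cq pq /existsP[r /and4P[rq cr pr qr]]] /eqP c'i /forallP cc']].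
have hs x : is_hole c0 x -> is_hole c (s x).
  move=> /forallP hx; apply/forallP => j; rewrite sE (inj_eq perm_inj); exact: hx.
have nsqr : s q0 != s r0 by rewrite (inj_eq perm_inj).
set p := position c i in pq pr.
have [pNq pNr] : p != q /\ p != r by split; [have := forallP cq i|have := forallP cr i].
have f : face (val p) (val q) (val r) by apply/and3P.
exists (s * tperm p q * tperm p r)%g; split.
- by rewrite !odd_permM !odd_tperm pNq pNr /= addbT negbK addbT.
- move=> j; rewrite !permM -sE; have [->|ji] := eqVneq j i.
    by rewrite -/p tpermL c'i tpermD // eq_sym.
  have -> : position c' j = position c j by apply/eqP/(implyP (cc' j)).
  have pj : p != position c j by rewrite (inj_eq (@position_inj _ _ c)) eq_sym.
  have [cjq cjr] : q != position c j /\ r != position c j.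
    by rewrite eq_sym (forallP cq j) eq_sym (forallP cr j).
  by rewrite !tpermD.
rewrite !permM.
have [/eqP eq|/eqP eq] := orP (two_holes nsqr (hs _ hq) (hs _ hr) cq).
  have er : r = s r0.
    have /orP[/eqP e|/eqP//] := two_holes nsqr (hs _ hq) (hs _ hr) cr.
    by rewrite eq e eqxx in rq.
  rewrite -eq -er tpermR tpermL (tpermD pNr) 1?eq_sym // tpermR.
  rewrite -eq -er in ds; rewrite face_rot in f.
  by case: (directedP f ds).
have er : r = s q0.
  have /orP[/eqP//|/eqP e] := two_holes nsqr (hs _ hq) (hs _ hr) cr.
  by rewrite eq e eqxx in rq.
rewrite -eq -er tpermR tpermL (tpermD pNr) 1?eq_sym // tpermR.
rewrite -eq -er in ds; rewrite face_rot faceC in f.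
by case: (directedP f ds).
Qed.

(** Exchanging two tiles keeps the holes, and their order is forced by the
    orientation, so the permutation that [even_slides] would provide is exactly
    that transposition, which is odd. *)
Lemma not_maximally_connected2 : ~ maximally_connected B 2.
Proof.
case=> [[c0 ic0] conn].
have [q0 [r0 [hq hr dqr]]] :
    exists q0 r0, [/\ is_hole c0 q0, is_hole c0 r0 & directed (val q0) (val r0)].
  case/existsP: (ic0)=> i /existsP[q /and3P[cq _ /existsP[r /and4P[_ cr _ qr]]]].
  by case/orP: (directed_total qr) => d; [exists q, r|exists r, q].
have t2 : 1 < #|` B| - 2 by lia.
pose a : tile B 2 := Ordinal (ltnW t2); pose b : tile B 2 := Ordinal t2.
pose f : {ffun tile B 2 -> B} := [ffun i => position c0 (tperm a b i)].
have inj : injectiveb f.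
  by apply/injectiveP => i j; rewrite !ffunE => /position_inj /perm_inj.
pose c1 : configuration B 2 :=
  exist (fun f : {ffun tile B 2 -> B} => is_true (injectiveb f)) f inj.
have c1E i : position c1 i = position c0 (tperm a b i) by rewrite /position /= ffunE.
have h1 x : is_hole c1 x = is_hole c0 x.
  apply/forallP/forallP => H i; last by rewrite c1E.
  by have := H (tperm a b i); rewrite c1E tpermK.
have ic1 : non_isolated c1.
  case/existsP: (ic0)=> i /existsP[q /and3P[cq pq /existsP[r H]]].
  apply/existsP; exists (tperm a b i); apply/existsP; exists q.
  apply/and3P; rewrite h1 c1E tpermK; split=> //.
  by apply/existsP; exists r; rewrite h1.
have [s [sev sE ds]] := even_slides hq hr dqr (conn _ _ ic0 ic1).
have hs x : is_hole c0 x -> is_hole c0 (s x).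
  rewrite -(h1 (s x)) => /forallP hx; apply/forallP => j; rewrite sE (inj_eq perm_inj); exact: hx.
have nqr : q0 != r0.
  by apply: contraTneq dqr => ->; apply/negP => /[dup] /directed_asym ->.
have sq : s q0 = q0 /\ s r0 = r0.
  have /orP[/eqP eq|/eqP eq] := two_holes nqr hq hr (hs _ hq);
  have /orP[/eqP er|/eqP er] := two_holes nqr hq hr (hs _ hr) => //.
  - by move/eqP: nqr; case; apply: (@perm_inj _ s); rewrite eq er.
  - by rewrite eq er (directed_asym dqr) in ds.
  - by move/eqP: nqr; case; apply: (@perm_inj _ s); rewrite eq er.
have nab : position c0 a != position c0 b by rewrite (inj_eq (@position_inj _ _ c0)).
have : s = tperm (position c0 a) (position c0 b).
  apply/permP => x; have [hx|] := boolP (is_hole c0 x).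
    rewrite tpermD; try exact: (forallP hx).
    by case/orP: (two_holes nqr hq hr hx) => /eqP->; case: sq.
  rewrite negb_forall => /existsP[i /negPn/eqP <-]; rewrite -sE c1E.
  by rewrite (inj_tperm _ _ _ (@position_inj _ _ c0)).
by move=> es; rewrite es odd_tperm nab in sev.
Qed.
End Parity.

(** * The connection number *)

Lemma connection_number3 (B : board) : 4 <= #|` B| -> maximally_connected B 3 ->
  connection_number_is B 3.
Proof.
move=> B4 mc; split=> // -[|[|[|h']]] // hB mch; exfalso.
- have [[c /existsP[i /existsP[q /and3P[cq _ _]]]] _] := mch.
  have := card_holes (leq0n _) c; rewrite (cardD1 q) inE cq; lia.
- have [[c /existsP[i /existsP[q /and3P[cq _ /existsP[r /and4P[rq cr _ _]]]]]] _] := mch.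
  have := card_holes (ltnW (ltnW (ltnW B4))) c.
  rewrite (cardD1 q) (cardD1 r) !inE cq cr rq; lia.
exact: not_maximally_connected2 mch.
Qed.

Lemma flexible_connection_number3 (B : board) (U : pred hexagon) x y z w :
    (forall p, (p \in B) = U p) -> face_in U x y z -> face_in U x y w -> w != z ->
  flexible B 3 U -> connection_number_is B 3.
Proof.
move=> UB F Fw wz gU; apply: connection_number3 (maximally_connected3 UB gU F Fw wz).
have /and4P[/and3P[/adjacent_neq xy /adjacent_neq yz /adjacent_neq xz] Ux Uy Uz] := F.
have /and4P[/and3P[_ /adjacent_neq yw /adjacent_neq xw] _ _ Uw] := Fw.
apply: (@uniq_leq_size _ [:: x; y; z; w]).
  by rewrite /= !inE !negb_or xy yz xz xw yw eq_sym wz.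
by move=> p; rewrite !inE UB => /or4P[] /eqP->.
Qed.

Theorem theorem1p7 :
  [/\ forall m1 m2 : nat, 3 <= m1 -> 3 <= m2 ->
        connection_number_is (parallelogram m1 m2) 3,
      forall m : nat, 5 <= m -> connection_number_is (triangle m) 3 &
      forall m : nat, 3 <= m -> connection_number_is (flower m) 3].
Proof.
split=> [m1 m2 m1_ge3 m2_ge3|m m_ge5|m m_ge3].
- have UB p : (p \in parallelogram m1 m2) = rhomboid id m1.-1 m2.-1 p.
    by rewrite in_parallelogram /rhomboid; lia.
  apply: (flexible_connection_number3 UB
    (x := (0, 0)%R) (y := (1, 1)%R) (z := (1, 0)%R) (w := (0, 1)%R)) => //.
  + by rewrite /face_in /= /rhomboid /=; lia.
  + by rewrite /face_in /= /rhomboid /=; lia.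
  by apply: (@flexible_rhomboid _ _ id); [by []|lia|lia|move=> x; rewrite UB].
- have UB p : (p \in triangle m) = triangle_at 0 m.-1 p.
    by rewrite in_triangle /triangle_at; lia.
  apply: (flexible_connection_number3 UB
    (x := (1, 0)%R) (y := (2, 1)%R) (z := (1, 1)%R) (w := (2, 0)%R)) => //.
  + by rewrite /face_in /= /triangle_at /=; lia.
  + by rewrite /face_in /= /triangle_at /=; lia.
  by apply: flexible_triangle; [lia|move=> x; rewrite UB].
have UB p : (p \in flower m) = hexdisk m.-1 p.
  by rewrite in_flower /hexdisk !ge_max; lia.
apply: (flexible_connection_number3 UB
    (x := (0, 0)%R) (y := (1, 1)%R) (z := (1, 0)%R) (w := (0, 1)%R)) => //.
+ by rewrite /face_in /= /hexdisk /=; lia.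
+ by rewrite /face_in /= /hexdisk /=; lia.
by apply: flexible_hexdisk; [lia|move=> x; rewrite UB].
Qed.
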